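(* Let $\Delta$ be a Stonean space and let $(\Delta,\{H_s\}_{s\in\Delta},\Omega)$ be a continuous Hilbert bundle over $\Delta$ with associated set $\Omega_{\rm wk}$ of bounded weakly continuous vector fields, equipped with its pointwise $C(\Delta)$-module action and its canonical $C(\Delta)$-valued inner product $\langle\cdot,\cdot\rangle$. Then $\Omega_{\rm wk}$ is a Kaplansky--Hilbert module over $C(\Delta)$.
   Context: A Stonean space is a compact, Hausdorff, extremally disconnected space. Inner products are linear in the first variable. A vector field on $\Delta$ with fibres $H_s$ (complex Hilbert spaces) is a function $\nu:\Delta\to\bigsqcup_s H_s$ with $\nu(s)\in H_s$ for all $s$. A continuous Hilbert bundle $(\Delta,\{H_s\}_{s\in\Delta},\Omega)$ consists of a set $\Omega$ of such vector fields such that: (I) $\Omega$ is a $C(\Delta)$-module under $(f\cdot\omega)(s)=f(s)\omega(s)$; (II) $\{\omega(s_0):\omega\in\Omega\}=H_{s_0}$ for every $s_0\in\Delta$; (III) $s\mapsto\|\omega(s)\|$ is continuous for every $\omega\in\Omega$; (IV) $\Omega$ is closed under local uniform approximation: if $\xi$ is a vector field such that for every $s_0\in\Delta$ and $\varepsilon>0$ there are an open set $U\ni s_0$ and $\omega\in\Omega$ with $\|\omega(s)-\xi(s)\|<\varepsilon$ for all $s\in U$, then $\xi\in\Omega$. A vector field $\nu$ is weakly continuous (with respect to $\Omega$) if $s\mapsto\langle\nu(s),\omega(s)\rangle$ is continuous for every $\omega\in\Omega$. $\Omega_{\rm wk}$ is the set of all weakly continuous $\nu$ with $\sup_s\|\nu(s)\|<\infty$;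 it is a $C(\Delta)$-module under the pointwise action. Canonical inner product: for $\nu_1,\nu_2\in\Omega_{\rm wk}$, $\langle\nu_1,\nu_2\rangle$ is the unique function in $C(\Delta)$ that agrees with $s\mapsto\langle\nu_1(s),\nu_2(s)\rangle$ off some meagre subset of $\Delta$. The norm is $\|\nu\|=\|\langle\nu,\nu\rangle\|^{1/2}$, which equals $\sup_s\|\nu(s)\|$. A Hilbert C$^*$-module over a C$^*$-algebra $B$ is a left $B$-module $E$ with a $B$-valued definite sesquilinear inner product such that $E$ is complete in the norm $\|\nu\|=\|\langle\nu,\nu\rangle\|^{1/2}$. It is a Kaplansky--Hilbert module if moreover $B$ is an abelian AW$^*$-algebra and: (i) if $e_i\cdot\nu=0$ for all $i$, for some family $\{e_i\}_i\subset B$ of pairwise orthogonal projections and some $\nu\in E$, then $e\cdot\nu=0$, where $e=\sup_i e_i$; (ii) if $\{e_i\}_i\subset B$ is a family of pairwise orthogonal projections with $\sup_i e_i=1$ and $\{\nu_i\}_i\subset E$ is a bounded family, then there is $\nu\in E$ with $e_i\cdot\nu=e_i\cdot\nu_i$ for all $i$; (iii) if $\nu\in E$ satisfies $g\cdot\nu=0$ for all $g\in B$, then $\nu=0$. *)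

(* Defs.v *)
From HB Require Import structures.
From mathcomp Require Import all_boot all_order all_algebra.
From mathcomp Require Import complex.
From mathcomp Require Import all_classical all_reals all_analysis.
Import Order.TTheory GRing.Theory Num.Theory Num.Def.
Import numFieldNormedType.Exports.

Set Implicit Arguments.
Unset Strict Implicit.
Unset Printing Implicit Defensive.

Local Open Scope classical_set_scope.
Local Open Scope ring_scope.

(* Naming the numClosedFieldType gives R[i] the canonical topology and normed
   module structure that MathComp-Analysis puts on every numClosedFieldType;
   its norm takes its values in R[i] itself, [normc] is the R-valued modulus. *)
Definition Cplx (R : realType) : numClosedFieldType := R[i].

Definition cmod (R : realType) (z : Cplx R) : R := ComplexField.Normc.normc z.

Section topology.
Variable T : topologicalType.

Definition extremally_disconnected :=
  forall U : set T, open U -> open (closure U).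

Definition nowhere_dense (A : set T) := interior (closure A) = set0.

Definition meagre (A : set T) :=
  exists2 F : nat -> set T,
    (forall n, nowhere_dense (F n)) & A `<=` \bigcup_n F n.

End topology.

HB.mixin Record isStonean T & Topological T := {
  stonean_compact : compact [set: T];
  stonean_hausdorff : hausdorff_space T;
  stonean_extremally_disconnected : extremally_disconnected T
}.

#[short(type="stoneanType")]
HB.structure Definition Stonean := {T of Topological T & isStonean T}.

Definition norm_complete (R : realType) (V : zmodType) (N : V -> R) :=
  forall u : nat -> V,
    (forall e : R, 0 < e -> exists k : nat, forall m n : nat,
       (k <= m)%N -> (k <= n)%N -> N (u m - u n) < e) ->
    exists l : V, N (u n - l) @[n --> \oo] --> (0 : R).

Section cstar_algebras.
(* The algebra structures of MathComp require 1 != 0, which fails for C(T) when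
   T is empty; hence the explicit scalar action on a pzRingType. *)
Variables (R : realType) (B : pzRingType).
Variables (scal : Cplx R -> B -> B) (star : B -> B) (nrm : B -> R).

Record is_cstar_algebra : Prop := {
  cstar_scalA : forall c d x, scal c (scal d x) = scal (c * d) x;
  cstar_scal1 : forall x, scal 1 x = x;
  cstar_scalDr : forall c x y, scal c (x + y) = scal c x + scal c y;
  cstar_scalDl : forall c d x, scal (c + d) x = scal c x + scal d x;
  cstar_scalAl : forall c x y, scal c (x * y) = scal c x * y;
  cstar_scalAr : forall c x y, scal c (x * y) = x * scal c y;
  cstar_norm_eq0 : forall x, nrm x = 0 -> x = 0;
  cstar_normD : forall x y, nrm (x + y) <= nrm x + nrm y;
  cstar_normZ : forall c x, nrm (scal c x) = cmod c * nrm x;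
  cstar_normM : forall x y, nrm (x * y) <= nrm x * nrm y;
  cstar_complete : norm_complete nrm;
  cstar_starK : forall x, star (star x) = x;
  cstar_starD : forall x y, star (x + y) = star x + star y;
  cstar_starZ : forall c x, star (scal c x) = scal c^* (star x);
  cstar_starM : forall x y, star (x * y) = star y * star x;
  cstar_identity : forall x, nrm (star x * x) = nrm x ^+ 2
}.

Definition projection (p : B) := star p = p /\ p * p = p.

Definition projection_le (p q : B) := p * q = p.

Definition orthogonal_projections (I : Type) (e : I -> B) :=
  (forall i, projection (e i)) /\ (forall i j, i <> j -> e i * e j = 0).

(* Least upper bound in the poset of projections. *)
Definition projection_sup (I : Type) (e : I -> B) (p : B) :=
  [/\ projection p,
      forall i, projection_le (e i) p &
      forall q, projection q -> (forall i, projection_le (e i) q) ->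
        projection_le p q].

(* Every right annihilator is generated, as a right ideal, by a projection. *)
Definition is_awstar_algebra :=
  is_cstar_algebra /\
  forall S : set B, exists2 p, projection p &
    [set x | forall s, S s -> s * x = 0] = [set p * b | b in [set: B]].

Variables (E : lmodType B) (ip : E -> E -> B).

Definition module_norm (v : E) : R := Num.sqrt (nrm (ip v v)).

Record is_hilbert_module : Prop := {
  hilbert_module_algebra : is_cstar_algebra;
  hilbert_module_ipDl : forall u v w, ip (u + v) w = ip u w + ip v w;
  hilbert_module_ipZl : forall (b : B) u v, ip (b *: u) v = b * ip u v;
  hilbert_module_ipC : forall u v, ip v u = star (ip u v);
  hilbert_module_ip_ge0 : forall u, exists b, ip u u = star b * b;
  hilbert_module_ip_definite : forall u, ip u u = 0 -> u = 0;
  hilbert_module_complete : norm_complete module_norm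
}.

Record is_kaplansky_hilbert_module : Prop := {
  KH_hilbert : is_hilbert_module;
  KH_abelian : forall x y : B, x * y = y * x;
  KH_awstar : is_awstar_algebra;
  KH_sup : forall (I : Type) (e : I -> B) (p : B) (v : E),
    orthogonal_projections e -> projection_sup e p ->
    (forall i, e i *: v = 0) -> p *: v = 0;
  KH_glue : forall (I : Type) (e : I -> B) (v_ : I -> E),
    orthogonal_projections e -> projection_sup e 1 ->
    (exists M : R, forall i, module_norm (v_ i) <= M) ->
    exists v : E, forall i, e i *: v = e i *: v_ i;
  KH_faithful : forall v : E, (forall g : B, g *: v = 0) -> v = 0
}.

End cstar_algebras.

Definition cfun (R : realType) (T : topologicalType) : Type :=
  continuousType T (Cplx R).

Definition cfun_eval (R : realType) (T : topologicalType) (f : cfun R T)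
  (s : T) : Cplx R := (f : continuousType T (Cplx R)) s.
Coercion cfun_eval : cfun >-> Funclass.

Section cfun_algebra.
Variables (R : realType) (T : topologicalType).
Local Notation C := (Cplx R).
Local Notation CT := (cfun R T).

HB.instance Definition _ := Choice.on CT.

Definition mk_cfun (f : T -> C) (cf : continuous f) : CT :=
  [the continuousType T C of mkcts cf].

Lemma cfun_cts (f : CT) : continuous (f : T -> C).
Proof. exact: (@cts_fun _ _ (f : continuousType T C)). Qed.

Lemma cfunP (f g : CT) : (f : T -> C) =1 g -> f = g.
Proof. by move=> fg; apply/continuousEP. Qed.

Lemma conjC_continuous : continuous (@conjC C).
Proof.
move=> z; apply: (proj2 (@cvgrPdist_lt C C C (nbhs z) _ _ _)) => e e0.
apply/(@nbhs_ballP _ C); exists e => //= t zt.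
by rewrite -rmorphB norm_conjC.
Qed.

Definition cfun_cst (c : C) : CT := mk_cfun (@cst_continuous T C c).

Lemma cfun_add_cts (f g : CT) : continuous ((fun s => f s + g s) : T -> C).
Proof. by move=> s; apply: cvgD; exact: cfun_cts. Qed.
Definition cfun_add f g : CT := mk_cfun (@cfun_add_cts f g).

Lemma cfun_opp_cts (f : CT) : continuous ((fun s => - f s) : T -> C).
Proof. by move=> s; apply: cvgN; exact: cfun_cts. Qed.
Definition cfun_opp f : CT := mk_cfun (@cfun_opp_cts f).

Lemma cfun_mul_cts (f g : CT) : continuous ((fun s => f s * g s) : T -> C).
Proof. by move=> s; apply: cvgM; exact: cfun_cts. Qed.
Definition cfun_mul f g : CT := mk_cfun (@cfun_mul_cts f g).

Lemma cfun_scale_cts (c : C) (f : CT) :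
  continuous ((fun s => c * f s) : T -> C).
Proof. by move=> s; apply: cvgM; [exact: cvg_cst|exact: cfun_cts]. Qed.
Definition cfun_scale c f : CT := mk_cfun (@cfun_scale_cts c f).

Lemma cfun_star_cts (f : CT) : continuous ((fun s => (f s)^*) : T -> C).
Proof.
move=> s; apply: (@continuous_comp _ _ _ (f : T -> C) (@conjC C)).
  exact: cfun_cts.
exact: conjC_continuous.
Qed.
Definition cfun_star f : CT := mk_cfun (@cfun_star_cts f).

Definition cfun_norm (f : CT) : R := sup (range (fun s => cmod (f s))).

Lemma cfun_addA : associative cfun_add.
Proof. by move=> f g h; apply/cfunP => s; exact: addrA. Qed.
Lemma cfun_addC : commutative cfun_add.
Proof. by move=> f g; apply/cfunP => s; exact: addrC. Qed.
Lemma cfun_add0 : left_id (cfun_cst 0) cfun_add.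
Proof. by move=> f; apply/cfunP => s; exact: add0r. Qed.
Lemma cfun_addN : left_inverse (cfun_cst 0) cfun_opp cfun_add.
Proof. by move=> f; apply/cfunP => s; exact: addNr. Qed.

HB.instance Definition _ :=
  GRing.isZmodule.Build CT cfun_addA cfun_addC cfun_add0 cfun_addN.

Lemma cfun_mulA : associative cfun_mul.
Proof. by move=> f g h; apply/cfunP => s; exact: mulrA. Qed.
Lemma cfun_mulC : commutative cfun_mul.
Proof. by move=> f g; apply/cfunP => s; exact: mulrC. Qed.
Lemma cfun_mul1 : left_id (cfun_cst 1) cfun_mul.
Proof. by move=> f; apply/cfunP => s; exact: mul1r. Qed.
Lemma cfun_mulDl : left_distributive cfun_mul +%R.
Proof. by move=> f g h; apply/cfunP => s; exact: mulrDl. Qed.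

HB.instance Definition _ :=
  GRing.Zmodule_isComPzRing.Build CT cfun_mulA cfun_mulC cfun_mul1 cfun_mulDl.

End cfun_algebra.

(* In [{dot H for conjC}] the form is linear in its first variable and
   conjugate-linear in the second one. *)
Record hilbertSpace (R : realType) := HilbertSpace {
  hilbert_carrier :> completeNormedModType (Cplx R);
  inner : {dot hilbert_carrier for @conjC (Cplx R)};
  inner_norm : forall x : hilbert_carrier, `|x| ^+ 2 = inner x x
}.

Record hilbertBundle (R : realType) (T : topologicalType) := HilbertBundle {
  fibre :> T -> hilbertSpace R;
  Omega : set (forall s, fibre s);
  Omega_zero : Omega (fun s => 0);
  Omega_add : forall w1 w2, Omega w1 -> Omega w2 -> Omega (fun s => w1 s + w2 s);
  Omega_scale : forall (f : cfun R T) w, Omega w -> Omega (fun s => f s *: w s);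
  Omega_total : forall s0, [set w s0 | w in Omega] = [set: fibre s0];
  Omega_norm : forall w, Omega w -> continuous ((fun s => `|w s|) : T -> Cplx R);
  Omega_local_uniform : forall xi : (forall s, fibre s),
    (forall s0 (e : Cplx R), 0 < e -> exists (U : set T) w,
       [/\ open U, U s0, Omega w & forall s, U s -> `|w s - xi s| < e]) ->
    Omega xi
}.

Definition weakly_continuous (R : realType) (T : topologicalType)
    (X : hilbertBundle R T) (v : forall s, X s) :=
  forall w, Omega w ->
    continuous ((fun s => inner (X s) (v s) (w s)) : T -> Cplx R).

Record wk_field (R : realType) (T : topologicalType) (X : hilbertBundle R T) :=
  WkField {
    wk_fun :> forall s, X s;
    wk_continuous : weakly_continuous wk_fun;
    wk_bounded : exists M : Cplx R, forall s, `|wk_fun s| <= M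
  }.

HB.instance Definition _ R T (X : hilbertBundle R T) :=
  gen_eqMixin (wk_field X).
HB.instance Definition _ R T (X : hilbertBundle R T) :=
  gen_choiceMixin (wk_field X).

Section wk_module.
Variables (R : realType) (D : stoneanType) (X : hilbertBundle R D).
Local Notation C := (Cplx R).
Local Notation Wk := (wk_field X).

Lemma wk_fieldP (u v : Wk) : (forall s, u s = v s) -> u = v.
Proof.
case: u v => [u uc ub] [v vc vb] /= uv.
have {}uv : u = v by apply/functional_extensionality_dep.
by subst v; congr WkField; exact: Prop_irrelevance.
Qed.

Lemma cfun_bounded (f : cfun R D) : exists M : C, forall s, `|f s| <= M.
Proof.
have [M fM] : exists M : C, [set: D] `<=` [set s | `|f s| <= M].
  apply: (@filter_ex _ (nbhs +oo)).
  apply: (proj1 (compact_near_coveringP [set: D]) stonean_compact C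
    (nbhs +oo) (fun M s => `|f s| <= M)) => x _ /=.
  have fx : \forall s \near x, `|f x - f s| < 1.
    apply: (proj1 (@cvgrPdist_lt C C D (nbhs x) _ f (f x))); last exact: ltr01.
    exact: cfun_cts.
  have fM : \forall M \near +oo, `|f x| + 1 <= M.
    by apply: nbhs_pinfty_ge; rewrite realE addr_ge0.
  near=> s M => /=.
  have -> : f s = f x - (f x - f s) by rewrite subKr.
  rewrite (le_trans (ler_normB _ _))//.
  apply: (@le_trans _ _ (`|f x| + 1)); last by near: M.
  by rewrite lerD2l ltW//; near: s.
by exists M => s; exact: fM.
Unshelve. all: by end_near. Qed.

Definition wk_zero_def (s : D) : X s := 0.
Lemma wk_zero_cts : weakly_continuous wk_zero_def.
Proof.
move=> w _; rewrite [X in continuous X](_ : _ = cst 0).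
  exact: cst_continuous.
by apply/funext => s; rewrite linear0l.
Qed.
Lemma wk_zero_bdd : exists M : C, forall s, `|wk_zero_def s| <= M.
Proof. by exists 0 => s; rewrite normr0. Qed.
Definition wk_zero : Wk := WkField wk_zero_cts wk_zero_bdd.

Lemma wk_add_cts (u v : Wk) : weakly_continuous (fun s => u s + v s).
Proof.
move=> w Ow; rewrite [X in continuous X](_ : _ =
  (fun s => inner (X s) (u s) (w s) + inner (X s) (v s) (w s))).
  by move=> s; apply: cvgD; [exact: (@wk_continuous _ _ _ u _ Ow)|exact: (@wk_continuous _ _ _ v _ Ow)].
by apply/funext => s; rewrite linearDl.
Qed.
Lemma wk_add_bdd (u v : Wk) : exists M : C, forall s, `|u s + v s| <= M.
Proof.
have [[M uM] [N vN]] := (wk_bounded u, wk_bounded v).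
by exists (M + N) => s; rewrite (le_trans (ler_normD _ _))// lerD.
Qed.
Definition wk_add (u v : Wk) : Wk := WkField (@wk_add_cts u v) (wk_add_bdd u v).

Lemma wk_scale_cts (f : cfun R D) (v : Wk) :
  weakly_continuous (fun s => f s *: v s).
Proof.
move=> w Ow; rewrite [X in continuous X](_ : _ =
  (fun s => f s * inner (X s) (v s) (w s))).
  by move=> s; apply: cvgM; [exact: cfun_cts|exact: (@wk_continuous _ _ _ v _ Ow)].
by apply/funext => s; rewrite linearZl_LR.
Qed.
Lemma wk_scale_bdd (f : cfun R D) (v : Wk) :
  exists M : C, forall s, `|f s *: v s| <= M.
Proof.
have [[M fM] [N vN]] := (cfun_bounded f, wk_bounded v).
exists (M * N) => s; rewrite normrZ.
by apply: ler_pM; [exact: normr_ge0|exact: normr_ge0|exact: fM|exact: vN].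
Qed.
Definition wk_scale f v : Wk := WkField (@wk_scale_cts f v) (wk_scale_bdd f v).

Lemma wk_addA : associative wk_add.
Proof. by move=> u v w; apply/wk_fieldP => s; exact: addrA. Qed.
Lemma wk_addC : commutative wk_add.
Proof. by move=> u v; apply/wk_fieldP => s; exact: addrC. Qed.
Lemma wk_add0 : left_id wk_zero wk_add.
Proof. by move=> u; apply/wk_fieldP => s; exact: add0r. Qed.
Lemma wk_addN : left_inverse wk_zero (wk_scale (- 1)) wk_add.
Proof. by move=> u; apply/wk_fieldP => s /=; rewrite scaleN1r addNr. Qed.

HB.instance Definition _ :=
  GRing.isZmodule.Build Wk wk_addA wk_addC wk_add0 wk_addN.

Lemma wk_scaleA f g v : wk_scale f (wk_scale g v) = wk_scale (f * g) v.
Proof. by apply/wk_fieldP => s; exact: scalerA. Qed.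
Lemma wk_scale1 : left_id 1 wk_scale.
Proof. by move=> v; apply/wk_fieldP => s; exact: scale1r. Qed.
Lemma wk_scaleDr : right_distributive wk_scale +%R.
Proof. by move=> f u v; apply/wk_fieldP => s; exact: scalerDr. Qed.
Lemma wk_scaleDl v : {morph wk_scale^~ v : f g / f + g}.
Proof. by move=> f g; apply/wk_fieldP => s; exact: scalerDl. Qed.

HB.instance Definition _ := GRing.Zmodule_isLmodule.Build (cfun R D) Wk
  wk_scaleA wk_scale1 wk_scaleDr wk_scaleDl.

Definition agrees_off_meagre (v1 v2 : Wk) (h : cfun R D) :=
  exists2 A : set D, meagre A &
    forall s, ~ A s -> h s = inner (X s) (v1 s) (v2 s).

(* The default value 0 of [xget] is irrelevant: over a Stonean space there is
   exactly one such function. *)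
Definition wk_inner (v1 v2 : Wk) : cfun R D :=
  xget 0 [set h | agrees_off_meagre v1 v2 h].

End wk_module.

(* Main.v *)
Require Import Defs.
From HB Require Import structures.
From mathcomp Require Import all_boot all_order all_algebra.
From mathcomp Require Import complex.
From mathcomp Require Import all_classical all_reals all_analysis.
From mathcomp Require Import ring lra.
Import Order.TTheory GRing.Theory Num.Theory.
Import numFieldNormedType.Exports.

Local Open Scope classical_set_scope.
Local Open Scope ring_scope.

(** Everything rests on one construction on an extremally disconnected space:
    a bounded lower semicontinuous function F has a continuous majorant g, its
    envelope, which equals F off a meagre set and at every point where F is
    continuous ([stone_envelope]).

    For a weakly continuous field nu the function s |-> |nu(s)|^2 is lower
    semicontinuous: with w in Omega and w(s0) = nu(s0), the continuous function
    2 Re <nu, w> - |w|^2 lies below |nu|^2 and touches it at s0.  Its envelope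
    is <nu, nu>, and polarization produces <nu1, nu2>; uniqueness is the Baire
    category theorem in a compact Hausdorff space.  As the envelope dominates
    |nu(s)|^2 at every point, and not just off a meagre set, the module norm is
    the supremum norm.  Definiteness follows at once, and completeness is the
    statement that uniform limits of weakly continuous fields are weakly
    continuous.  The algebraic identities for the inner product hold pointwise
    off a meagre set, hence everywhere.

    As the closure of an open set is clopen, its indicator is a projection of
    C(Delta).  The annihilator of a set S of functions is therefore generated by
    the indicator of the complement of the closure of the union of the supports
    of S, and a supremum of projections lives on the closure of the union of
    their supports ([projection_sup_closure]).  The latter gives axiom (i), since
    the zero set of a weakly continuous field is closed.

    For the gluing axiom (ii), the fields nu_i fit together to a field nu0 on
    the dense open union U of the supports of the e_i.  For w in Omega, the
    function Re <nu0, w> is bounded and continuous on U, so it extends to a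
    continuous function G_w on Delta (a second use of the envelope).  By density
    of U, the bound |G_w(s)| <= M |w(s)| and the real linearity of w |-> G_w
    persist on Delta, so that w(s) |-> G_w(s) is a well-defined bounded
    real-linear functional on each fibre; the Riesz representation theorem turns
    it into the value at s of the glued field.

    Inner products enter mostly through their real parts, which determine them
    because Im <x, y> = Re <x, i y>, and which spare the complex arithmetic. *)

(** * Extremally disconnected spaces and Baire category *)

Section meagre.
Context {T : topologicalType}.

Lemma meagre_sub (A B : set T) : A `<=` B -> meagre B -> meagre A.
Proof. by move=> AB [F F0 BF]; exists F => //; exact: subset_trans BF. Qed.

Lemma meagreU (A B : set T) : meagre A -> meagre B -> meagre (A `|` B).
Proof.
move=> [F F0 AF] [G G0 BG].
exists (fun n => if odd n then F n./2 else G n./2); first by move=> n; case: odd.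
move=> s [/AF[n _ Fs]|/BG[n _ Gs]].
  by exists n.*2.+1 => //=; rewrite odd_double/= uphalf_double.
by exists n.*2 => //=; rewrite odd_double doubleK.
Qed.

End meagre.

Section topology.
Context {R : realType} {T : topologicalType}.

(** The Baire category theorem: by regularity, nonempty open sets O_n can be
    chosen with closure O_(n+1) contained in O_n and disjoint from the closure of
    the n-th nowhere dense set; compactness gives a point in all of them. *)
Lemma compact_hausdorff_baire (A O : set T) : compact [set: T] ->
  hausdorff_space T -> meagre A -> open O -> O !=set0 ->
  exists2 x, O x & ~ A x.
Proof.
move=> cT hT [F F0 AF] oO O0.
pose good := [set U : set T | open U /\ U !=set0].
have step (x : set T * nat) : {y : set T * nat | y.2 = x.2.+1 /\
    (good x.1 -> good y.1 /\ closure y.1 `<=` x.1 `\` closure (F x.2))}.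
  apply: cid; case: x => U n /=.
  have [[oU [a Ua]]|] := pselect (good U); last by exists (U, n.+1).
  have [b Ub Fb] : exists2 b, U b & ~ closure (F n) b.
    apply: contrapT => H; suff : interior (closure (F n)) a by rewrite F0.
    apply: filterS (open_nbhs_nbhs (conj oU Ua)) => y Uy.
    by apply: contrapT => Fy; apply: H; exists y.
  have [|V bV VU] := compact_regular hT cT (@filterT _ (nbhs b) _)
      (t := U `\` closure (F n)).
    apply: open_nbhs_nbhs; split=> //.
    by rewrite setDE; apply: openI => //; apply: closed_openC; exact: closed_closure.
  exists (interior V, n.+1); split=> //= _; split.
    by split; [exact: open_interior|exists b].
  by apply: subset_trans VU; apply: closureS; exact: interior_subset.
have [f [f0 fS]] := dependent_choice step (O, 0%N).
have fn n : (f n).2 = n by elim: n => [|n IH]; [rewrite f0|rewrite (fS n).1 IH].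
have fgood n : good (f n).1.
  by elim: n => [|n IH]; [rewrite f0|exact: ((fS n).2 IH).1].
have fsub n : closure (f n.+1).1 `<=` (f n).1 `\` closure (F n).
  by rewrite -[in F n](fn n); exact: ((fS n).2 (fgood n)).2.
have fmono m n : (m <= n)%N -> (f n).1 `<=` (f m).1.
  move=> /subnK <-; elim: (n - m)%N => [//|k IH]; rewrite addSn.
  by move=> x /subset_closure/fsub[fx _]; exact: IH.
(* Otherwise every x has a neighbourhood disjoint from O_m for all large m, so
   by compactness some O_n is empty. *)
have [x fx] : exists x, forall n, closure (f n).1 x.
  apply: contrapT => H.
  have [n fn0] : exists n, [set: T] `<=` [set y | ~ (f n).1 y].
    apply: (@filter_ex _ (\oo : set_system nat)).
    apply: (proj1 (compact_near_coveringP [set: T]) cT nat \oo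
      (fun n y => ~ (f n).1 y)) => x _ /=.
    have [n] : exists n, ~ closure (f n).1 x.
      apply: contrapT => H'; apply: H; exists x => n.
      by apply: contrapT => H''; apply: H'; exists n.
    move=> /existsNP[B /not_implyP[xB fB]].
    exists (B, [set m | (n <= m)%N]); first by split => //=; exists n.
    move=> [y m] [/= By nm] fy; apply: fB; exists y; split=> //.
    exact: fmono nm _ fy.
  by have [_ [y fy]] := fgood n; exact: (fn0 y).
exists x; first by have [] := fsub 0%N x (fx 1%N); rewrite f0.
move=> /AF[n _ Fx]; have [_] := fsub n x (fx n.+1); apply.
exact: subset_closure.
Qed.

(** Equals the upper semicontinuous envelope of F.  The formula through the sets
    closure {F > a}, which are clopen for lower semicontinuous F, makes both
    {g < a} and {g > a} visibly open. *)
Definition stone_envelope (F : T -> R) (s : T) : R :=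
  sup [set a | closure [set t | a < F t] s].

Section envelope.
Variables (F : T -> R) (M : R).
Hypothesis edT : extremally_disconnected T.
Hypothesis F_lsc : forall a, open [set t | a < F t].
Hypothesis F_ge : forall t, - M <= F t.
Hypothesis F_le : forall t, F t <= M.

Let E s : set R := [set a | closure [set t | a < F t] s].

Let E_down s a b : a <= b -> E s b -> E s a.
Proof. by move=> ab; apply: closureS => t /=; exact: le_lt_trans. Qed.

Let E_ub s : ubound (E s) M.
Proof.
move=> a Ea; rewrite leNgt; apply/negP => Ma.
have [t [/= /lt_le_trans/(_ (F_le t))]] := Ea setT filterT.
by move=> /(lt_trans Ma); rewrite ltxx.
Qed.

Let E_sup s : has_sup (E s).
Proof.
split; last by exists M; exact: E_ub.
exists (- M - 1); apply: subset_closure => /=.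
by rewrite (lt_le_trans _ (F_ge s))// ltrBlDr ltrDl.
Qed.

Let gt_envP s a : a < stone_envelope F s <-> exists2 b, a < b & E s b.
Proof.
split=> [|[b ab Eb]]; last first.
  by rewrite (lt_le_trans ab)//; exact: (ub_le_sup (E_sup s).2).
rewrite -subr_gt0 => /sup_adherent /(_ (E_sup s))[b Eb].
by rewrite subKr; exists b.
Qed.

Let lt_envP s a : stone_envelope F s < a <-> exists2 b, b < a & ~ E s b.
Proof.
split=> [ga|[b ba Eb]].
  exists ((stone_envelope F s + a) / 2); first lra.
  move=> /(ub_le_sup (E_sup s).2); rewrite -/(stone_envelope F s); lra.
rewrite (le_lt_trans _ ba)//; apply: ge_sup; first exact: (E_sup s).1.
move=> c Ec; rewrite leNgt; apply/negP => bc; apply: Eb.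
exact: E_down (ltW bc) Ec.
Qed.

Lemma stone_envelope_continuous : continuous (stone_envelope F).
Proof.
have op a : open (E ^~ a) by exact: edT.
have cl a : open [set s | ~ E s a].
  by apply: closed_openC; exact: closed_closure.
move=> s; apply/cvgrPdist_lt => e e0.
have [b ltb Eb] : exists2 b, stone_envelope F s - e < b & E s b.
  by apply/gt_envP; rewrite ltrBlDr ltrDl.
have [c ltc Ec] : exists2 c, c < stone_envelope F s + e & ~ E s c.
  by apply/lt_envP; rewrite ltrDl.
have Nb : nbhs s (E ^~ b) by apply: open_nbhs_nbhs.
have Nc : nbhs s [set s | ~ E s c] by apply: open_nbhs_nbhs.
near=> t; rewrite distrC ltr_distl; apply/andP; split.
  by apply/gt_envP; exists b => //; near: t.
by apply/lt_envP; exists c => //; near: t.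
Unshelve. all: by end_near. Qed.

Lemma stone_envelope_ge s : F s <= stone_envelope F s.
Proof.
rewrite leNgt; apply/negP => gF.
have [b bF []] := (lt_envP _ _).1 gF.
exact: subset_closure.
Qed.

Lemma stone_envelope_le s : stone_envelope F s <= M.
Proof. by apply: ge_sup; [exact: (E_sup s).1|exact: E_ub]. Qed.

Lemma stone_envelope_eq s :
  {for s, continuous F} -> stone_envelope F s = F s.
Proof.
move=> cF; apply/le_anti; rewrite stone_envelope_ge andbT leNgt.
apply/negP => /gt_envP[b Fb Eb].
have [t [/= bt tb]] := Eb [set t | F t < b] (@cvgr_lt _ _ _ _ _ (F s) cF _ Fb).
by move: (lt_trans bt tb); rewrite ltxx.
Qed.

(** If F s < q < g s with q rational, then s lies in the boundary of the open set
    {F > q}; such boundaries are nowhere dense, and there are countably many. *)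
Lemma stone_envelope_meagre : meagre [set s | stone_envelope F s != F s].
Proof.
pose B a := E ^~ a `\` [set t | a < F t].
exists (fun n => if unpickle n is Some q then B (ratr q) else set0).
  move=> n; case: unpickle => [q|]; last first.
    by rewrite /nowhere_dense closure0 interior0.
  have Bcl : closed (B (ratr q)).
    rewrite /B setDE; apply: closedI; first exact: closed_closure.
    exact: open_closedC.
  rewrite /nowhere_dense -((closure_id _).1 Bcl).
  apply/seteqP; split=> // s sB.
  by have [t [qF [_ []]]] := (nbhs_singleton sB).1 _ sB.
move=> s /= gF.
have : F s < stone_envelope F s by rewrite lt_neqAle eq_sym gF stone_envelope_ge.
move=> /gt_envP[b /rat_in_itvoo[q]]; rewrite in_itv/= => /andP[Fq qb] Eb.
exists (pickle q); first by [].
suff : B (ratr q) s by rewrite pickleK.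
split; first exact: E_down (ltW qb) Eb.
by move=> /=; rewrite ltNge (ltW Fq).
Qed.

End envelope.

(** Setting F to its lower bound off U makes it lower semicontinuous on T without
    affecting its continuity at the points of U, where the envelope is thus F. *)
Lemma dense_extension (U : set T) (F : T -> R) (M : R) :
  extremally_disconnected T -> open U -> (forall s, U s -> `|F s| <= M) ->
  (forall s, U s -> {for s, continuous F}) ->
  exists2 g : T -> R, continuous g & forall s, U s -> g s = F s.
Proof.
move=> edT oU FM cF.
have [[u Uu]|U0] := pselect (U !=set0); last first.
  exists (cst 0); first exact: cst_continuous.
  by move=> s Us; exfalso; apply: U0; exists s.
have M0 : 0 <= M := le_trans (normr_ge0 _) (FM u Uu).
pose G s := if pselect (U s) then F s else - M.
have GU s : U s -> G s = F s by rewrite /G; case: pselect.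
have Gle s : - M <= G s <= M.
  rewrite /G; case: pselect => [Us|_] /=; last by rewrite lexx/=; lra.
  by have := FM s Us; rewrite ler_norml.
have Gc s : U s -> {for s, continuous G}.
  move=> Us; rewrite /prop_for /continuous_at GU//.
  apply: cvg_trans (cF s Us); apply: near_eq_cvg.
  near=> t; rewrite GU//; near: t; exact: open_nbhs_nbhs.
have Glsc a : open [set t | a < G t].
  have [aM|Ma] := ltP a (- M).
    rewrite (_ : [set t | a < G t] = setT); first exact: openT.
    by apply/seteqP; split=> // t _ /=; have /andP[+ _] := Gle t; exact: lt_le_trans.
  rewrite openE => s /= aG.
  have Us : U s.
    apply: contrapT => Us; move: aG; rewrite /G.
    by case: pselect => //= _; rewrite ltNge Ma.
  exact: (@cvgr_gt _ _ _ _ _ (G s) (Gc s Us) _ aG).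
have G1 t : - M <= G t by have /andP[] := Gle t.
have G2 t : G t <= M by have /andP[] := Gle t.
exists (stone_envelope G); first exact: (stone_envelope_continuous _ M).
by move=> s Us; rewrite (stone_envelope_eq _ M) ?GU//; exact: Gc.
Unshelve. all: by end_near. Qed.

End topology.

(** * Continuity and limits *)

Lemma eq_on_closure {S T : topologicalType} (f : S -> T) (c : T) (A : set S) :
  hausdorff_space T -> continuous f -> (forall s, A s -> f s = c) ->
  forall s, closure A s -> f s = c.
Proof.
move=> hT fc fA s As.
have cl : closed (f @^-1` [set c]).
  apply: closed_comp; first by move=> x _; exact: fc.
  by apply: accessible_closed_set1; exact: hausdorff_accessible.
by move: (closureS fA As); rewrite -((closure_id _).1 cl).
Qed.

(** The approximation is local so that it applies to <u_k, w> for uniformly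
    convergent fields u_k: its rate depends on a bound for |w|, which the
    continuity of |w| provides near each point. *)
Lemma locally_uniform_continuous {R : realType} {T : topologicalType} (l : T -> R) :
  (forall s e, 0 < e -> exists2 g : T -> R, {for s, continuous g} &
     \forall t \near s, `|g t - l t| <= e) ->
  continuous l.
Proof.
move=> lg s; apply/cvgrPdist_le => e e0.
have e3 : 0 < e / 3 by rewrite divr_gt0.
have [g gc gl] := lg s _ e3.
have gs := nbhs_singleton gl.
have gn := proj1 (cvgrPdist_le _ _) gc _ e3.
near=> t.
have -> : l s - l t = - (g s - l s) + (g s - g t) + (g t - l t) by ring.
have -> : e = e / 3 + e / 3 + e / 3 by field.
apply: le_trans (ler_normD _ _) _; apply: lerD; last by near: t.
apply: le_trans (ler_normD _ _) _; rewrite normrN; apply: lerD => //.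
by near: t; exact: gn.
Unshelve. all: by end_near. Qed.

Lemma cvg_seq_eps {R : realType} (x : nat -> R) : (forall n, 0 <= x n) ->
  (forall e, 0 < e -> exists k, forall n, (k <= n)%N -> x n <= e) ->
  x n @[n --> \oo] --> (0 : R).
Proof.
move=> x0 xe; apply/cvgrPdist_le => e e0; have [k xk] := xe _ e0.
by exists k => // n /= kn; rewrite sub0r normrN ger0_norm ?xk.
Qed.

Lemma seq_eps_cvg {R : realType} (x : nat -> R) :
  x n @[n --> \oo] --> (0 : R) ->
  forall e, 0 < e -> exists k, forall n, (k <= n)%N -> x n < e.
Proof.
move=> /cvgrPdist_lt x0 e /x0[k _ xk]; exists k => n kn.
by have := xk n kn; rewrite sub0r normrN; apply: le_lt_trans; exact: ler_norm.
Qed.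

(** Stated for dependent families W with a distance at each point, so that it
    applies both to scalar functions and to vector fields of a bundle. *)
Lemma uniform_limit {R : realType} (S : Type) (W : S -> zmodType)
    (N : forall s, W s -> R) (u : nat -> forall s, W s) :
  (forall s (x y z : W s), N s (x - z) <= N s (x - y) + N s (y - z)) ->
  (forall s, norm_complete (N s)) ->
  (forall e, 0 < e -> exists k, forall m n, (k <= m)%N -> (k <= n)%N ->
     forall s, N s (u m s - u n s) < e) ->
  exists l : forall s, W s, forall e, 0 < e -> exists k, forall n, (k <= n)%N ->
    forall s, N s (u n s - l s) <= e.
Proof.
move=> ND Nc uC.
have hl : forall s, exists x : W s,
    N s (u n s - x) @[n --> \oo] --> (0 : R).
  move=> s; apply: Nc => e /uC[k uk]; exists k => m n km kn; exact: uk.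
pose l s := sval (cid (hl s)); have ul s := svalP (cid (hl s)).
exists l => e e0; have [k uk] := uC _ e0; exists k => n kn s.
apply/ler_addgt0Pr => d d0; have [j uj] := seq_eps_cvg _ (ul s) _ d0.
apply: (le_trans (ND _ _ (u (maxn k j) s) _)); rewrite lerD//.
  by rewrite ltW// uk// leq_maxl.
by rewrite ltW// uj// leq_maxr.
Qed.

(** * Complex numbers and Hilbert spaces through real parts *)

Section complex.
Context {R : realType}.
Local Notation C := (Cplx R).

Lemma normC_cmod (z : C) : `|z| = (cmod z)%:C%C :> C.
Proof. by []. Qed.

Lemma ler_Re_cmod (z : C) : `|complex.Re z| <= cmod z.
Proof.
rewrite /cmod; case: z => a b /=; rewrite -sqrtr_sqr ler_sqrt.
  by rewrite lerDl sqr_ge0.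
by rewrite addr_ge0// sqr_ge0.
Qed.

Lemma ler_Im_cmod (z : C) : `|complex.Im z| <= cmod z.
Proof.
rewrite /cmod; case: z => a b /=; rewrite -sqrtr_sqr ler_sqrt.
  by rewrite lerDr sqr_ge0.
by rewrite addr_ge0// sqr_ge0.
Qed.

Lemma cmod_ReIm (z : C) : cmod z <= `|complex.Re z| + `|complex.Im z|.
Proof.
rewrite /cmod; case: z => a b /=.
rewrite -[leRHS]ger0_norm ?addr_ge0// -sqrtr_sqr ler_sqrt ?sqr_ge0//.
rewrite sqrrD !real_normK ?num_real// addrAC lerDl mulrn_wge0// mulr_ge0//.
Qed.

Lemma cmod_real (a : R) : cmod (a%:C%C : C) = `|a|.
Proof. by rewrite /cmod /= expr0n addr0 sqrtr_sqr. Qed.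

Lemma cmodM (z w : C) : cmod (z * w) = cmod z * cmod w.
Proof. exact: ComplexField.Normc.normcM. Qed.

Lemma cmodD (z w : C) : cmod (z + w) <= cmod z + cmod w.
Proof. by have := ler_normD z w; rewrite !normC_cmod -rmorphD lecR. Qed.

Lemma cmod_ge0 (z : C) : 0 <= cmod z.
Proof. by have := normr_ge0 z; rewrite normC_cmod ler0c. Qed.

Lemma cmodJ (z : C) : cmod z^* = cmod z.
Proof. by have := norm_conjC z; rewrite !normC_cmod => -[]. Qed.

Lemma cmod0_eq (z : C) : cmod z = 0 -> z = 0.
Proof. by move=> z0; apply/normr0_eq0; rewrite normC_cmod z0. Qed.

Lemma Re_continuous : continuous (@complex.Re R : C -> R).
Proof.
move=> z; apply: (proj2 (@cvgrPdist_lt R R C (nbhs z) _ _ _)) => e e0.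
have : \forall t \near z, `|z - t| < e%:C%C.
  apply: (proj1 (@cvgrPdist_lt C C C (nbhs z) _ id z)); last by rewrite ltcR.
  exact: cvg_id.
apply: filterS => t; rewrite normC_cmod ltcR -raddfB.
by apply: le_lt_trans; exact: ler_Re_cmod.
Qed.

Lemma Im_continuous : continuous (@complex.Im R : C -> R).
Proof.
move=> z; apply: (proj2 (@cvgrPdist_lt R R C (nbhs z) _ _ _)) => e e0.
have : \forall t \near z, `|z - t| < e%:C%C.
  apply: (proj1 (@cvgrPdist_lt C C C (nbhs z) _ id z)); last by rewrite ltcR.
  exact: cvg_id.
apply: filterS => t; rewrite normC_cmod ltcR -raddfB.
by apply: le_lt_trans; exact: ler_Im_cmod.
Qed.

Lemma ReIm_continuous (T : topologicalType) (a b : T -> R) :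
  continuous a -> continuous b -> continuous ((fun s => (a s +i* b s)%C) : T -> C).
Proof.
move=> ca cb s; apply: (proj2 (@cvgrPdist_lt C C T (nbhs s) _ _ _)) => e e0.
have [e' e'0 ->] : exists2 e' : R, 0 < e' & e = e'%:C%C.
  move: e0; case: e => x y; rewrite ltcE /= => /andP[/eqP -> x0].
  by exists x.
have e2 : 0 < e' / 2 by rewrite divr_gt0.
have na := proj1 (cvgrPdist_lt _ _) (ca s) _ e2.
have nb := proj1 (cvgrPdist_lt _ _) (cb s) _ e2.
near=> t; rewrite normC_cmod ltcR (le_lt_trans (cmod_ReIm _))//=.
rewrite (splitr e') ltrD//; first by near: t; exact: na.
by near: t; exact: nb.
Unshelve. all: by end_near. Qed.

End complex.

Section hilbert_space.
Context {R : realType}.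
Local Notation C := (Cplx R).

Definition iC : C := 'i%C.

Definition rnorm {H : hilbertSpace R} (x : H) : R := complex.Re `|x|.

Definition rinner {H : hilbertSpace R} (x y : H) : R := complex.Re (inner H x y).

Section one_space.
Context {H : hilbertSpace R}.
Implicit Types x y z : H.

Lemma normC_rnorm x : `|x| = (rnorm x)%:C%C.
Proof. by rewrite /rnorm RRe_real// normr_real. Qed.

Lemma rnorm_ge0 x : 0 <= rnorm x.
Proof. by rewrite -ler0c -normC_rnorm. Qed.

Lemma rnormD x y : rnorm (x + y) <= rnorm x + rnorm y.
Proof. by rewrite -lecR rmorphD/= -!normC_rnorm ler_normD. Qed.

Lemma rnormN x : rnorm (- x) = rnorm x.
Proof. by rewrite /rnorm normrN. Qed.

Lemma rnorm0 : rnorm (0 : H) = 0.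
Proof. by rewrite /rnorm normr0. Qed.

Lemma rnorm_triangle x y z : rnorm (x - z) <= rnorm (x - y) + rnorm (y - z).
Proof. by rewrite -[x - z](subrKA y) rnormD. Qed.

Lemma rnorm0_eq0 x : rnorm x = 0 -> x = 0.
Proof. by move=> x0; apply/normr0_eq0; rewrite normC_rnorm x0. Qed.

Lemma rnormZ (c : C) x : rnorm (c *: x) = cmod c * rnorm x.
Proof.
by apply: (@complexI R); rewrite rmorphM/= -!normC_rnorm normrZ normC_cmod.
Qed.

Lemma rnorm_sqr x : rnorm x ^+ 2 = rinner x x.
Proof.
by rewrite /rinner -inner_norm normC_rnorm -rmorphXn.
Qed.

Lemma rinnerDl x y z : rinner (x + y) z = rinner x z + rinner y z.
Proof. by rewrite /rinner linearDl raddfD. Qed.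

Lemma innerJ x y : inner H y x = (inner H x y)^*.
Proof. by rewrite hermC expr0 mul1r. Qed.

Lemma rinnerC x y : rinner x y = rinner y x.
Proof. by rewrite /rinner innerJ; case: (inner _ _ _). Qed.

Lemma rinnerDr x y z : rinner x (y + z) = rinner x y + rinner x z.
Proof. by rewrite !(rinnerC x) rinnerDl. Qed.

Lemma rinnerZl (a : R) x y : rinner (a%:C%C *: x) y = a * rinner x y.
Proof.
by rewrite /rinner linearZl_LR/=; case: (inner _ _ _) => p q /=; rewrite mul0r subr0.
Qed.

Lemma rinnerZr (a : R) x y : rinner x (a%:C%C *: y) = a * rinner x y.
Proof. by rewrite !(rinnerC x) rinnerZl. Qed.

Lemma rinnerNl x y : rinner (- x) y = - rinner x y.
Proof. by rewrite /rinner linearNl raddfN. Qed.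

Lemma rinnerNr x y : rinner x (- y) = - rinner x y.
Proof. by rewrite !(rinnerC x) rinnerNl. Qed.

(** The real part of the inner product determines the whole of it. *)
Lemma Im_inner x y : complex.Im (inner H x y) = rinner x (iC *: y).
Proof.
rewrite /rinner linearZr_LR/=; case: (inner _ _ _) => p q /=.
by rewrite mul0r mulN1r sub0r opprK.
Qed.

Lemma rnormD_sqr x y :
  rnorm (x + y) ^+ 2 = rnorm x ^+ 2 + 2 * rinner x y + rnorm y ^+ 2.
Proof. rewrite !rnorm_sqr !rinnerDl !rinnerDr (rinnerC y x); ring. Qed.

Lemma rnormB_sqr x y :
  rnorm (x - y) ^+ 2 = rnorm x ^+ 2 - 2 * rinner x y + rnorm y ^+ 2.
Proof. rewrite rnormD_sqr rnormN rinnerNr; ring. Qed.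

Lemma rinner_polar x y :
  rinner x y = (rnorm (x + y) ^+ 2 - rnorm (x - y) ^+ 2) / 4.
Proof. by rewrite rnormD_sqr rnormB_sqr; lra. Qed.

(** Cauchy-Schwarz, from expanding the square of | |y| x - |x| y |. *)
Lemma rinner_le x y : `|rinner x y| <= rnorm x * rnorm y.
Proof.
suff CS (u v : H) : rinner u v <= rnorm u * rnorm v.
  by rewrite ler_norml CS lerNl -rinnerNl -(rnormN x) CS.
have [u0|u0] := eqVneq (rnorm u) 0.
  by rewrite (rnorm0_eq0 _ u0) /rinner linear0l rnorm0 mul0r.
have [v0|v0] := eqVneq (rnorm v) 0.
  by rewrite (rnorm0_eq0 _ v0) /rinner linear0r rnorm0 mulr0.
have up : 0 < rnorm u by rewrite lt_neqAle eq_sym u0 rnorm_ge0.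
have vp : 0 < rnorm v by rewrite lt_neqAle eq_sym v0 rnorm_ge0.
have := sqr_ge0 (rnorm ((rnorm v)%:C%C *: u - (rnorm u)%:C%C *: v)).
rewrite rnormB_sqr !rnormZ !cmod_real !ger0_norm ?rnorm_ge0// rinnerZl rinnerZr.
set a := rnorm u in up *; set b := rnorm v in vp *; set r := rinner u v => h.
rewrite -(@ler_pM2l _ (a * b)) ?mulr_gt0//; nra.
Qed.

Lemma hilbert_complete : norm_complete (@rnorm H).
Proof.
move=> u uC.
have cu : cvg (u n @[n --> \oo]).
  apply/cauchy_cvgP; apply/cauchy_exP => e.
  move: e => [x y]; rewrite ltcE /= => /andP[/eqP -> x0].
  have [k uk] := uC _ x0; exists (u k).
  exists k => // n /= kn; rewrite -ball_normE /ball_ /= normC_rnorm ltcR.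
  exact: uk.
exists (lim (u n @[n --> \oo])).
apply/cvgrPdist_lt => e e0.
have : \forall n \near \oo, `|lim (u n @[n --> \oo]) - u n| < e%:C%C.
  by apply: (proj1 (cvgrPdist_lt _ _) cu); rewrite ltcR.
apply: filterS => n; rewrite normC_rnorm ltcR sub0r normrN.
by rewrite ger0_norm ?rnorm_ge0// -opprB rnormN.
Qed.

End one_space.
End hilbert_space.

Section riesz.
Context {R : realType} {H : hilbertSpace R}.

(** The representing vector minimizes J x = |x|^2 - 2 phi x, which is bounded
    below by - M^2.  The parallelogram law makes minimizing sequences Cauchy, and
    the first-order condition at the limit v is Re <v, y> = phi y.  Only real
    linearity is asked of phi, as it is the real part of a functional. *)
Lemma riesz (phi : H -> R) (M : R) :
  {morph phi : x y / x + y} ->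
  (forall (a : R) x, phi (a%:C%C *: x) = a * phi x) ->
  (forall x, `|phi x| <= M * rnorm x) ->
  exists2 v : H, forall x, rinner v x = phi x & rnorm v <= `|M|.
Proof.
move=> phiD phiZ phiM.
pose J x := rnorm x ^+ 2 - 2 * phi x.
have Jge x : - M ^+ 2 <= J x.
  have := phiM x; rewrite ler_norml => /andP[_ ].
  by rewrite /J; have := sqr_ge0 (rnorm x - M); nra.
have hJ : has_inf (range J).
  split; first by exists (J 0), 0.
  by exists (- M ^+ 2) => _ [x _ <-].
set m := inf (range J).
have mJ x : m <= J x by apply: (inf_lbound hJ.2); exists x.
have J_add (x y : H) t :
    J (x + t%:C%C *: y) = J x + 2 * t * (rinner x y - phi y) + t ^+ 2 * rnorm y ^+ 2.
  rewrite /J rnormD_sqr rnormZ phiD phiZ rinnerZr cmod_real exprMn real_normK ?num_real//.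
  by lra.
have near_min (d : R) : 0 < d -> exists x, J x < m + d.
  move=> d0; have [_ [x _ <-] Jx] := inf_adherent d0 hJ; exists x.
  by rewrite -ltrBlDr in Jx *.
(* The parallelogram law, as J is at least m at the midpoint of x and y. *)
have J_dist x y : rnorm (x - y) ^+ 2 <= 2 * (J x - m) + 2 * (J y - m).
  have := mJ (x + (2^-1)%:C%C *: (y - x)).
  rewrite J_add rnormB_sqr rnormB_sqr rinnerDr rinnerNr -rnorm_sqr phiD.
  have -> : phi (- x) = - phi x.
    by rewrite -[- x]scaleN1r -(rmorphN1 (real_complex R)) phiZ mulN1r.
  rewrite (rinnerC y x) /J; set r := rinner x y; set a := rnorm x; set b := rnorm y.
  by lra.
have /choice[x Jx] : forall n : nat, exists x, J x < m + n.+1%:R^-1.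
  by move=> n; apply: near_min; rewrite invr_gt0.
have x_le (e : R) : 0 < e -> exists k, forall n, (k <= n)%N -> n.+1%:R^-1 < e.
  move=> e0; have [k _ ke] := near_infty_natSinv_lt (PosNum e0); exists k => n; exact: ke.
have [|v xv] := hilbert_complete x.
  move=> e e0; have [|k ke] := x_le (e ^+ 2 / 4); first by rewrite divr_gt0// exprn_gt0.
  exists k => p q kp kq; rewrite -(@ltr_pXn2r _ 2)// ?nnegrE ?rnorm_ge0 ?ltW//.
  have := J_dist (x p) (x q); have := Jx p; have := Jx q.
  have := ke _ kp; have := ke _ kq.
  by set z1 := p.+1%:R^-1; set z2 := q.+1%:R^-1; clearbody z1 z2; lra.
(* Minimality against x n + t y, in the limit in n. *)
have key y t : 2 * t * (phi y - rinner v y) <= t ^+ 2 * rnorm y ^+ 2.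
  apply/ler_addgt0Pr => d d0.
  have [k1 ke] := x_le _ (divr_gt0 d0 (ltr0Sn R 1)).
  pose c := 2 * `|t| * rnorm y + 1.
  have c0 : 0 < c by rewrite ltr_wpDl// !mulr_ge0// rnorm_ge0.
  have [k2 kx] := seq_eps_cvg _ xv _ (divr_gt0 (divr_gt0 d0 (ltr0Sn R 1)) c0).
  pose n := maxn k1 k2.
  have := mJ (x n + t%:C%C *: y); rewrite J_add.
  have := Jx n; have := ke n (leq_maxl _ _); have := kx n (leq_maxr _ _).
  set z := n.+1%:R^-1; move=> xn zd Jn mJn.
  suff : 2 * t * (rinner (x n) y - rinner v y) <= d / 2 by lra.
  rewrite -rinnerNl -rinnerDl; apply: le_trans (ler_norm _) _.
  rewrite normrM normrM (ger0_norm (ler0n _ 2)).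
  have := rinner_le (x n - v) y; have : rnorm (x n - v) * c < d / 2.
    by rewrite -ltr_pdivlMr.
  have := rnorm_ge0 (x n - v); have := rnorm_ge0 y; have := normr_ge0 t.
  rewrite /c; set r := rnorm (x n - v); set b := rnorm y; set T := `|t|.
  set w := `| _ |; move=> T0 b0 r0 rc wrb.
  apply: (@le_trans _ _ (2 * T * (r * b))); first by rewrite ler_wpM2l// mulr_ge0.
  by lra.
have vphi y : rinner v y = phi y.
  apply/eqP; rewrite -subr_eq0 -oppr_eq0 opprB; set c := phi y - _.
  rewrite -sqrf_eq0 eq_le sqr_ge0 andbT.
  pose N := rnorm y ^+ 2; have N0 : 0 <= N by rewrite sqr_ge0.
  (* This t makes the linear term of the inequality beat the quadratic one. *)
  have := key y (c / (N + 1)); rewrite -/c -/N.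
  have N1 : 0 < N + 1 by lra.
  set t := c / (N + 1); have -> : c = t * (N + 1) by rewrite divfK// gt_eqF.
  clearbody t; move: (sqr_ge0 t) => t0 h; rewrite exprMn.
  suff -> : t ^+ 2 = 0 by rewrite mul0r.
  by apply/le_anti; rewrite t0 andbT; nra.
exists v => //.
have := phiM v; rewrite -vphi -rnorm_sqr ger0_norm ?sqr_ge0// expr2.
have [->|v0] := eqVneq (rnorm v) 0; first by [].
rewrite ler_pM2r ?lt_neqAle 1?eq_sym ?v0 ?rnorm_ge0// => vM.
exact: le_trans vM (ler_norm _).
Qed.

End riesz.

(** * The algebra of continuous functions on a Stonean space *)

Lemma mk_cfunE {R : realType} {T : topologicalType} (f : T -> Cplx R)
    (fc : continuous f) (s : T) : mk_cfun fc s = f s.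
Proof. by []. Qed.

(** The set where f and g differ is open, so by Baire it cannot be a nonempty
    subset of a meagre set. *)
Lemma cfun_eq_off_meagre {R : realType} {D : stoneanType} (f g : cfun R D)
    (A : set D) : meagre A -> (forall s, ~ A s -> f s = g s) -> f = g.
Proof.
move=> mA fg; apply/cfunP => s; apply: contrapT => /eqP fgs.
pose O : set D := [set t | f t - g t != 0].
have [||t fgt /fg] := compact_hausdorff_baire A O
    stonean_compact stonean_hausdorff mA; last first.
- by apply/eqP; rewrite -subr_eq0; exact: fgt.
- by exists s; rewrite /O /= subr_eq0.
have fgc : continuous ((fun t => f t - g t) : D -> Cplx R).
  by move=> t; apply: cvgB; exact: cfun_cts.
rewrite (_ : O = (fun t => f t - g t) @^-1` [set z | z != 0])//.
move/continuousP: fgc; apply.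
have -> : [set z : Cplx R | z != 0] = ~` [set 0].
  by apply/seteqP; split=> z /eqP.
rewrite openC; apply: accessible_closed_set1; apply: hausdorff_accessible.
exact: norm_hausdorff.
Qed.

Section continuous_functions.
Context {R : realType} {D : stoneanType}.
Local Notation C := (Cplx R).
Local Notation CT := (cfun R D).
Local Notation proj := (projection (@cfun_star R D)).
Local Notation psup := (projection_sup (@cfun_star R D)).
Implicit Types f g : CT.

Lemma cfunME f g s : cfun_eval (f * g) s = f s * g s.
Proof. by []. Qed.

Lemma cfun_starE f s : cfun_star f s = (f s)^*.
Proof. by []. Qed.

Lemma cmod_le_cfun_norm f s : cmod (f s) <= cfun_norm f.
Proof.
have [M fM] := cfun_bounded f.
apply: ub_le_sup; last by exists s.
exists (complex.Re M) => _ [t _ <-].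
by have := fM t; rewrite normC_cmod lecE => /andP[].
Qed.

Lemma cfun_norm_le f (M : R) : 0 <= M -> (forall s, cmod (f s) <= M) ->
  cfun_norm f <= M.
Proof.
move=> M0 fM; rewrite /cfun_norm.
have [->|/set0P ne] := eqVneq (range (fun s => cmod (f s))) set0.
  by rewrite sup0.
by apply: ge_sup => // _ [s _ <-].
Qed.

Lemma cfun_norm_ge0 f : 0 <= cfun_norm f.
Proof.
rewrite /cfun_norm.
have [->|/set0P [_ [s _ _]]] := eqVneq (range (fun s => cmod (f s))) set0.
  by rewrite sup0.
exact: le_trans (cmod_ge0 (f s)) (cmod_le_cfun_norm _ _).
Qed.

Lemma cmod_complete : norm_complete (@cmod R).
Proof.
move=> u uC.
have part (p : {additive C -> R}) : (forall z, `|p z| <= cmod z) ->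
    exists l : R, p (u n) @[n --> \oo] --> l.
  move=> ple; suff : cvg (p (u n) @[n --> \oo]) by exists (lim (p (u n) @[n --> \oo])).
  apply/cauchy_cvgP; apply/cauchy_exP => e e0.
  have [k uk] := uC _ e0; exists (p (u k)).
  exists k => // n /= kn; rewrite -ball_normE /ball_ /= -raddfB.
  apply: le_lt_trans (ple _) _; exact: uk.
have [a ua] := part (@complex.Re R) ler_Re_cmod.
have [b ub] := part (@complex.Im R) ler_Im_cmod.
exists (a +i* b)%C; apply: cvg_seq_eps => [n|e e0]; first exact: cmod_ge0.
have e2 : 0 < e / 2 by rewrite divr_gt0.
have [k1 _ h1] := proj1 (cvgrPdist_le _ _) ua _ e2.
have [k2 _ h2] := proj1 (cvgrPdist_le _ _) ub _ e2.
exists (maxn k1 k2) => n; rewrite geq_max => /andP[n1 n2].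
apply: le_trans (cmod_ReIm _) _; rewrite (splitr e) !raddfB/=.
by rewrite lerD// distrC; [exact: h1|exact: h2].
Qed.

Lemma cfun_uniform_limit (l : D -> C) :
  (forall e, 0 < e -> exists f : CT, forall s, cmod (f s - l s) <= e) ->
  continuous l.
Proof.
move=> lf.
have -> : l = (fun s => (complex.Re (l s) +i* complex.Im (l s))%C).
  by apply/funext => s; case: (l s).
apply: ReIm_continuous; apply: locally_uniform_continuous => s e /lf[f fl].
- exists (fun t => complex.Re (f t)).
    apply: (@continuous_comp D C R f (@complex.Re R)); first exact: cfun_cts.
    exact: Re_continuous.
  apply: nearW => t; rewrite -raddfB; exact: le_trans (ler_Re_cmod _) (fl t).
- exists (fun t => complex.Im (f t)).
    apply: (@continuous_comp D C R f (@complex.Im R)); first exact: cfun_cts.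
    exact: Im_continuous.
  apply: nearW => t; rewrite -raddfB; exact: le_trans (ler_Im_cmod _) (fl t).
Qed.

Lemma cfun_complete : norm_complete (@cfun_norm R D).
Proof.
move=> u uC.
have [|||l ul] := @uniform_limit R D (fun=> C) (fun=> @cmod R) (fun n => u n : D -> C).
- by move=> _ x y z; rewrite -[x - z](subrKA y); exact: cmodD.
- by move=> _; exact: cmod_complete.
- move=> e /uC[k uk]; exists k => m n km kn s.
  exact: le_lt_trans (cmod_le_cfun_norm (u m - u n) s) (uk m n km kn).
have lc : continuous l.
  apply: cfun_uniform_limit => e /ul[k uk]; exists (u k); exact: uk.
exists (mk_cfun lc); apply: cvg_seq_eps => [n|e /[dup] e0 /ul[k uk]].
  exact: cfun_norm_ge0.
exists k => n kn; apply: cfun_norm_le; first exact: ltW.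
exact: uk.
Qed.

Lemma cfun_cstar :
  is_cstar_algebra (@cfun_scale R D) (@cfun_star R D) (@cfun_norm R D).
Proof.
split.
- by move=> c d x; apply/cfunP => s; exact: mulrA.
- by move=> x; apply/cfunP => s; exact: mul1r.
- by move=> c x y; apply/cfunP => s; exact: mulrDr.
- by move=> c d x; apply/cfunP => s; exact: mulrDl.
- by move=> c x y; apply/cfunP => s; exact: mulrA.
- by move=> c x y; apply/cfunP => s; exact: mulrCA.
- move=> x x0; apply/cfunP => s; apply: cmod0_eq; apply/le_anti.
  by rewrite cmod_ge0 -x0 cmod_le_cfun_norm.
- move=> x y; apply: cfun_norm_le => [|s]; first by rewrite addr_ge0// cfun_norm_ge0.
  by apply: le_trans (cmodD _ _) _; rewrite lerD// cmod_le_cfun_norm.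
- move=> c x; apply/le_anti/andP; split.
    apply: cfun_norm_le => [|s]; first by rewrite mulr_ge0// ?cmod_ge0 ?cfun_norm_ge0.
    rewrite [cfun_scale c x s]mk_cfunE cmodM.
    by rewrite ler_wpM2l ?cmod_ge0 ?cmod_le_cfun_norm.
  have [->|c0] := eqVneq (cmod c) 0; first by rewrite mul0r cfun_norm_ge0.
  have cp : 0 < cmod c by rewrite lt_neqAle eq_sym c0 cmod_ge0.
  rewrite mulrC -ler_pdivlMr//; apply: cfun_norm_le => [|s].
    by rewrite divr_ge0 ?cmod_ge0 ?cfun_norm_ge0.
  rewrite ler_pdivlMr// mulrC -cmodM.
  exact: (cmod_le_cfun_norm (cfun_scale c x) s).
- move=> x y; apply: cfun_norm_le => [|s]; first by rewrite mulr_ge0// cfun_norm_ge0.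
  rewrite cfunME cmodM.
  by apply: ler_pM; rewrite ?cmod_ge0// cmod_le_cfun_norm.
- exact: cfun_complete.
- by move=> x; apply/cfunP => s; exact: conjCK.
- by move=> x y; apply/cfunP => s; exact: rmorphD.
- by move=> c x; apply/cfunP => s; exact: rmorphM.
- by move=> x y; apply/cfunP => s; rewrite mulrC; exact: rmorphM.
- move=> x.
  have E s : cmod (cfun_eval (cfun_star x * x) s) = cmod (cfun_eval x s) ^+ 2.
    by rewrite cfunME cmodM cfun_starE cmodJ.
  apply/le_anti/andP; split.
    apply: cfun_norm_le => [|s]; first exact: sqr_ge0.
    by rewrite E ler_pXn2r ?nnegrE ?cmod_ge0 ?cfun_norm_ge0 ?cmod_le_cfun_norm.
  have n0 := cfun_norm_ge0 (cfun_star x * x).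
  rewrite -[leRHS]sqr_sqrtr// ler_pXn2r ?nnegrE ?cfun_norm_ge0 ?sqrtr_ge0//.
  apply: cfun_norm_le => [|s]; first exact: sqrtr_ge0.
  rewrite -[leLHS]ger0_norm ?cmod_ge0// -sqrtr_sqr ler_sqrt//.
  by rewrite -E cmod_le_cfun_norm.
Qed.

Lemma cfun_support_open f : open [set s | f s != 0].
Proof.
have /continuousP fc := @cfun_cts _ _ f.
rewrite (_ : [set s | _] = f @^-1` ~` [set 0]).
  apply: fc; rewrite openC; apply: accessible_closed_set1.
  by apply: hausdorff_accessible; exact: norm_hausdorff.
by apply/seteqP; split=> s /=; [move=> /eqP|move=> f0; apply/eqP].
Qed.

Lemma indicator_continuous (U : set D) : open U -> closed U ->
  continuous ((fun s => (s \in U)%:R) : D -> C).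
Proof.
move=> oU cU s; apply: cvg_near_cst; have [sU|sU] := boolP (s \in U).
  have : nbhs s U by apply: open_nbhs_nbhs; split => //; exact: set_mem.
  by apply: filterS => t tU; rewrite mem_set.
have : nbhs s (~` U).
  by apply: open_nbhs_nbhs; split; [rewrite openC|apply/set_mem; rewrite in_setC].
by apply: filterS => t tU; rewrite memNset.
Qed.

Definition clopen_indicator (U : set D) (oU : open U) (cU : closed U) : CT :=
  mk_cfun (indicator_continuous U oU cU).

Lemma clopen_indicator_projection (U : set D) (oU : open U) (cU : closed U) :
  projection (@cfun_star R D) (clopen_indicator U oU cU).
Proof.
split; apply/cfunP => s.
  by rewrite cfun_starE mk_cfunE conjC_nat.
by rewrite cfunME mk_cfunE; case: (s \in U); rewrite ?mul1r ?mul0r.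
Qed.

Definition closure_indicator (U : set D) (oU : open U) : CT :=
  clopen_indicator (closure U) (stonean_extremally_disconnected U oU)
    (@closed_closure _ U).

(** A function annihilates S exactly if it vanishes on the union U of the supports
    of the members of S, or equivalently, by continuity, on its clopen closure. *)
Lemma cfun_awstar :
  is_awstar_algebra (@cfun_scale R D) (@cfun_star R D) (@cfun_norm R D).
Proof.
split; first exact: cfun_cstar.
move=> S; pose U := \bigcup_(f in S) [set s | cfun_eval f s != 0].
have oU : open U by apply: bigcup_open => f _; exact: cfun_support_open.
have oK : open (~` closure U) by rewrite openC; exact: closed_closure.
have cK : closed (~` closure U).
  by rewrite closedC; exact: stonean_extremally_disconnected.
exists (clopen_indicator (~` closure U) oK cK); first exact: clopen_indicator_projection.
apply/seteqP; split=> [x Sx|_ [b _ <-] f Sf].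
  exists x => //; apply/cfunP => s; rewrite cfunME mk_cfunE.
  have [_|] := boolP (s \in _); first by rewrite mul1r.
  rewrite mul0r notin_setE /= => /contrapT sU; apply/esym.
  apply: (eq_on_closure (cfun_eval x) 0 U _ (@cfun_cts _ _ x) _ s sU).
    exact: norm_hausdorff.
  move=> t [f Sf /= ft]; apply/eqP.
  have : cfun_eval (f * x) t = 0 by rewrite (Sx f Sf).
  by rewrite cfunME => /eqP; rewrite mulf_eq0 (negbTE ft).
apply/cfunP => s; rewrite cfunME; have [->|fs] := eqVneq (cfun_eval f s) 0.
  by rewrite mul0r.
rewrite cfunME mk_cfunE memNset ?mul0r ?mulr0//.
by apply; apply: subset_closure; exists f.
Qed.

Lemma support_union_open (I : Type) (e : I -> CT) :
  open [set s | exists i, e i s != 0].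
Proof.
rewrite (_ : [set s | _] = \bigcup_i [set s | e i s != 0]).
  by apply: bigcup_open => i _; exact: cfun_support_open.
by apply/seteqP; split=> s [j]; [exists j|move=> _ ?; exists j].
Qed.

(** The indicator of the clopen set closure U is a projection above every e i,
    hence above p. *)
Lemma projection_sup_closure (I : Type) (e : I -> CT) (p : CT) (U : set D)
    (s : D) : open U -> (forall i, proj (e i)) -> psup e p ->
  (forall i s, e i s != 0 -> U s) -> p s != 0 -> closure U s.
Proof.
move=> oU pe [pp _ p_least] eU ps.
have /p_least : proj (closure_indicator U oU) by exact: clopen_indicator_projection.
have eq i : projection_le (e i) (closure_indicator U oU).
  apply/cfunP => t; rewrite cfunME mk_cfunE.
  have [->|/eU Ut] := eqVneq (cfun_eval (e i) t) 0; first by rewrite mul0r.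
  by rewrite mem_set ?mulr1//; exact: subset_closure.
move=> /(_ eq) pq; apply: contrapT => sU.
have : cfun_eval (p * closure_indicator U oU) s = cfun_eval p s by rewrite pq.
rewrite cfunME mk_cfunE memNset// mulr0 => p0.
by move: ps; rewrite -p0 eqxx.
Qed.

End continuous_functions.

(** * The canonical inner product *)

Section canonical_inner_product.
Context {R : realType} {D : stoneanType} {X : hilbertBundle R D}.
Local Notation C := (Cplx R).
Implicit Types u v : wk_field X.

(** The imaginary part of <v, w> is the real part of <v, i w>, and i w is in Omega
    along with w. *)
Lemma weakly_continuousP (v : forall s, X s) :
  weakly_continuous v <->
  forall w, Omega w -> continuous (fun s => rinner (v s) (w s)).
Proof.
split=> [vc w Ow s|vc w Ow].
  apply: (@continuous_comp D C R (fun s => inner (X s) (v s) (w s))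
    (@complex.Re R)); first exact: vc.
  exact: Re_continuous.
have -> : (fun s => inner (X s) (v s) (w s)) =
    (fun s => (rinner (v s) (w s) +i* rinner (v s) (iC *: w s))%C).
  by apply/funext => s; rewrite -Im_inner /rinner; case: (inner _ _ _).
apply: ReIm_continuous; first exact: vc.
exact: (vc _ (@Omega_scale _ _ X (cfun_cst D iC) w Ow)).
Qed.

Lemma Omega_rnorm (w : forall s, X s) : Omega w -> continuous (fun s => rnorm (w s)).
Proof.
move=> Ow s; apply: (@continuous_comp D C R (fun s => `|w s|)
    (@complex.Re R)); first exact: (@Omega_norm _ _ _ _ Ow).
exact: Re_continuous.
Qed.

Lemma Omega_through (s : D) (x : X s) : exists2 w, Omega w & w s = x.
Proof. by have : setT x by []; rewrite -(Omega_total X s) => -[w]; exists w. Qed.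

(** |v|^2 is bounded below by the continuous function 2 Re <v, w> - |w|^2, with
    equality at s when w in Omega is chosen to pass through v s. *)
Lemma weakly_continuous_rnorm_lsc (v : forall s, X s) (a : R) :
  weakly_continuous v -> open [set s | a < rnorm (v s) ^+ 2].
Proof.
move=> /weakly_continuousP vc; rewrite openE => s /= av.
have [w Ow ws] := Omega_through s (v s).
pose f t := 2 * rinner (v t) (w t) - rnorm (w t) ^+ 2.
have fc : {for s, continuous f}.
  apply: cvgB; first by apply: cvgM; [exact: cvg_cst|exact: vc].
  by apply: cvgM; exact: Omega_rnorm.
have fs : f s = rnorm (v s) ^+ 2 by rewrite /f ws -rnorm_sqr; ring.
have := @cvgr_gt _ _ _ _ _ (f s) fc a; rewrite fs => /(_ _ av).
apply: filterS => t /= aft; apply: lt_le_trans aft _.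
have := sqr_ge0 (rnorm (v t - w t)); rewrite rnormB_sqr /f; lra.
Qed.

Lemma wk_rnorm_bounded u : exists2 M : R, 0 <= M & forall s, rnorm (u s) <= M.
Proof.
have [M uM] := wk_bounded u; exists `|complex.Re M| => // s.
apply: le_trans (ler_norm _).
have := uM s; rewrite normC_rnorm.
by rewrite lecE /= => /andP[].
Qed.

Definition rnorm2_envelope u : D -> R :=
  stone_envelope (fun s => rnorm (u s) ^+ 2).

Section envelope_facts.
Variable u : wk_field X.

Let env_hyp (M : R) : (forall s, rnorm (u s) <= M) ->
  [/\ forall a : R, open [set s | a < rnorm (u s) ^+ 2],
      forall s, - M ^+ 2 <= rnorm (u s) ^+ 2 &
      forall s, rnorm (u s) ^+ 2 <= M ^+ 2].
Proof.
move=> uM; split=> [a|s|s].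
- exact: weakly_continuous_rnorm_lsc (@wk_continuous _ _ _ u).
- by have := sqr_ge0 (rnorm (u s)); have := sqr_ge0 M; lra.
- by have := uM s; have := rnorm_ge0 (u s); nra.
Qed.

Lemma rnorm2_envelope_continuous : continuous (rnorm2_envelope u).
Proof.
have [M _ /env_hyp[]] := wk_rnorm_bounded u.
exact/stone_envelope_continuous/stonean_extremally_disconnected.
Qed.

Lemma rnorm2_envelope_ge s : rnorm (u s) ^+ 2 <= rnorm2_envelope u s.
Proof.
have [M _ /env_hyp[h1 h2 h3]] := wk_rnorm_bounded u.
exact: (stone_envelope_ge _ _ h2).
Qed.

Lemma rnorm2_envelope_le (M : R) :
  (forall s, rnorm (u s) <= M) -> forall s, rnorm2_envelope u s <= M ^+ 2.
Proof.
move=> /env_hyp[h1 h2 h3] s; exact: stone_envelope_le.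
Qed.

Lemma rnorm2_envelope_meagre :
  meagre [set s | rnorm2_envelope u s != rnorm (u s) ^+ 2].
Proof.
have [M _ /env_hyp[h1 h2 h3]] := wk_rnorm_bounded u.
exact: (stone_envelope_meagre _ (M ^+ 2)).
Qed.

End envelope_facts.

Lemma wk_fieldB u v s : (u - v) s = u s - v s.
Proof. by rewrite -[- v s]scaleN1r. Qed.

(** By polarization, since sums and differences of weakly continuous fields are
    weakly continuous. *)
Lemma rinner_extension u v : exists2 g : D -> R, continuous g &
  meagre [set s | g s != rinner (u s) (v s)].
Proof.
exists (fun s => (rnorm2_envelope (u + v) s - rnorm2_envelope (u - v) s) / 4).
  move=> s; apply: cvgM; last exact: cvg_cst.
  by apply: cvgB; exact: rnorm2_envelope_continuous.
apply: meagre_sub (meagreU _ _ (rnorm2_envelope_meagre (u + v))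
                           (rnorm2_envelope_meagre (u - v))) => s /=.
have [puv|] := eqVneq (rnorm2_envelope (u + v) s) (rnorm ((u + v) s) ^+ 2);
  last by left.
have [muv|] := eqVneq (rnorm2_envelope (u - v) s) (rnorm ((u - v) s) ^+ 2);
  last by right.
rewrite puv muv rinner_polar => /eqP []; congr ((_ - rnorm _ ^+ 2) / 4).
exact: wk_fieldB.
Qed.

Lemma agrees_off_meagre_exists u v : exists h : cfun R D, agrees_off_meagre u v h.
Proof.
have [g gc gm] := rinner_extension u v.
have [g' gc' gm'] := rinner_extension u (cfun_cst D iC *: v).
exists (mk_cfun (ReIm_continuous _ _ _ gc gc')).
exists ([set s | g s != rinner (u s) (v s)] `|`
        [set s | g' s != rinner (u s) ((cfun_cst D iC *: v : wk_field X) s)]).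
  exact: meagreU.
move=> s /not_orP[/negP + /negP]; rewrite !negbK => /eqP gs /eqP gs'.
by rewrite mk_cfunE gs gs' -Im_inner /rinner; case: (inner _ _ _).
Qed.

Lemma agrees_off_meagre_unique u v (h k : cfun R D) :
  agrees_off_meagre u v h -> agrees_off_meagre u v k -> h = k.
Proof.
move=> [A mA hA] [B mB kB]; apply: (cfun_eq_off_meagre _ _ _ (meagreU _ _ mA mB)).
by move=> s /not_orP[As Bs]; rewrite hA// kB.
Qed.

Lemma wk_innerP u v : agrees_off_meagre u v (wk_inner u v).
Proof.
rewrite /wk_inner; case: xgetP => [h _ //|h0].
by have [h] := agrees_off_meagre_exists u v => /h0.
Qed.

Lemma wk_inner_eq u v (h : cfun R D) : agrees_off_meagre u v h -> wk_inner u v = h.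
Proof. exact: agrees_off_meagre_unique (wk_innerP u v). Qed.

(** Links the inner product, defined only off a meagre set, to a function that
    dominates |u s|^2 at every single point. *)
Lemma wk_innerE u s : wk_inner u u s = (rnorm2_envelope u s)%:C%C.
Proof.
rewrite (_ : wk_inner u u = mk_cfun (ReIm_continuous _ _ _ (rnorm2_envelope_continuous u)
    (@cst_continuous D R 0)))//.
apply: wk_inner_eq; exists [set s | rnorm2_envelope u s != rnorm (u s) ^+ 2].
  exact: rnorm2_envelope_meagre.
move=> t /negP; rewrite negbK => /eqP ut.
by rewrite mk_cfunE ut -inner_norm normC_rnorm -rmorphXn.
Qed.

End canonical_inner_product.

(** * The Hilbert module of weakly continuous fields *)

Section hilbert_module.
Context {R : realType} {D : stoneanType} {X : hilbertBundle R D}.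
Local Notation C := (Cplx R).
Local Notation CT := (cfun R D).
Local Notation mnorm := (module_norm (@cfun_norm R D) (@wk_inner R D X)).
Implicit Types u v w : wk_field X.

Lemma rnorm_le_module_norm u s : rnorm (u s) <= mnorm u.
Proof.
rewrite /module_norm -[leLHS]ger0_norm ?rnorm_ge0// -sqrtr_sqr ler_sqrt ?cfun_norm_ge0//.
apply: le_trans (rnorm2_envelope_ge u s) _.
have := cmod_le_cfun_norm (wk_inner u u) s; rewrite wk_innerE cmod_real.
exact: le_trans (ler_norm _).
Qed.

Lemma module_norm_le u (M : R) : 0 <= M -> (forall s, rnorm (u s) <= M) ->
  mnorm u <= M.
Proof.
move=> M0 uM; rewrite /module_norm -[leRHS]ger0_norm// -sqrtr_sqr ler_sqrt ?sqr_ge0//.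
apply: cfun_norm_le => [|s]; first exact: sqr_ge0.
rewrite wk_innerE cmod_real ger0_norm; first exact: rnorm2_envelope_le.
exact: le_trans (sqr_ge0 _) (rnorm2_envelope_ge u s).
Qed.

(** The module norm dominates the norm in each fibre, so a Cauchy sequence has a
    limit l uniformly over the fibres; l is weakly continuous because
    |<u_k - l, w>| <= |u_k - l| |w| and |w| is locally bounded. *)
Lemma module_complete : norm_complete mnorm.
Proof.
move=> u uC.
have [|||l ul] := @uniform_limit R D (fun s => X s) (fun s => @rnorm R (X s))
  (fun n => u n : forall s, X s).
- by move=> s; exact: rnorm_triangle.
- by move=> s; exact: hilbert_complete.
- move=> e /uC[k uk]; exists k => m n km kn s.
  by rewrite -wk_fieldB; exact: le_lt_trans (rnorm_le_module_norm _ s) (uk m n km kn).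
have lc : weakly_continuous l.
  apply/weakly_continuousP => w Ow; apply: locally_uniform_continuous => s e e0.
  pose W := rnorm (w s) + 1.
  have W0 : 0 < W by rewrite ltr_wpDl ?rnorm_ge0.
  have [k uk] := ul _ (divr_gt0 e0 W0).
  exists (fun t => rinner (u k t) (w t)).
    exact: (proj1 (weakly_continuousP _) (@wk_continuous _ _ _ (u k)) w Ow).
  have wW : \forall t \near s, rnorm (w t) < W.
    apply: (@cvgr_lt _ _ _ _ _ (rnorm (w s)) (Omega_rnorm w Ow s)).
    by rewrite ltrDl.
  apply: filterS wW => t wW.
  rewrite -rinnerNl -rinnerDl; apply: le_trans (rinner_le _ _) _.
  have -> : e = e / W * W by rewrite divfK// gt_eqF.
  by apply: ler_pM; rewrite ?rnorm_ge0 ?uk// ltW.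
have lb : exists M : C, forall s, `|l s| <= M.
  have [k uk] := ul _ ltr01.
  have [M M0 uM] := wk_rnorm_bounded (u k).
  exists (1 + M)%:C%C => s; rewrite normC_rnorm lecR.
  have -> : l s = - (u k s - l s) + u k s by rewrite opprB subrK.
  by apply: le_trans (rnormD _ _) _; rewrite rnormN lerD// uk.
exists (WkField lc lb); apply: cvg_seq_eps => [n|e /[dup] e0 /ul[k uk]].
  exact: sqrtr_ge0.
exists k => n kn; apply: module_norm_le; first exact: ltW.
by move=> s; rewrite wk_fieldB; exact: uk.
Qed.

Lemma wk_inner_hilbert_module :
  is_hilbert_module (@cfun_scale R D) (@cfun_star R D) (@cfun_norm R D)
    (@wk_inner R D X).
Proof.
split.
- exact: cfun_cstar.
- move=> u v w; apply: wk_inner_eq.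
  have [A mA hA] := wk_innerP u w; have [B mB hB] := wk_innerP v w.
  exists (A `|` B); first exact: meagreU.
  move=> s /not_orP[As Bs].
  by rewrite (_ : cfun_eval _ s = wk_inner u w s + wk_inner v w s)// hA// hB// -linearDl.
- move=> b u v; apply: wk_inner_eq.
  have [A mA hA] := wk_innerP u v; exists A => // s As.
  by rewrite cfunME hA// -linearZl_LR.
- move=> u v; apply: wk_inner_eq.
  have [A mA hA] := wk_innerP u v; exists A => // s As.
  by rewrite cfun_starE hA// -innerJ.
(* <u, u> is the envelope, nonnegative at every point, so its pointwise square
   root is a continuous self-adjoint b with <u, u> = b^* b. *)
- move=> u.
  have gc : continuous (fun s => Num.sqrt (rnorm2_envelope u s)).
    move=> s; apply: (@continuous_comp D R R (rnorm2_envelope u) Num.sqrt).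
      exact: rnorm2_envelope_continuous.
    exact: sqrt_continuous.
  exists (mk_cfun (ReIm_continuous _ _ _ gc (@cst_continuous D R 0))).
  apply/cfunP => s.
  rewrite [LHS]wk_innerE cfunME cfun_starE mk_cfunE.
  rewrite -[(_ +i* 0)%C]/((Num.sqrt (rnorm2_envelope u s))%:C%C).
  rewrite [X in X * _](_ : _ = (Num.sqrt (rnorm2_envelope u s))%:C%C); last exact: conjc_real.
  rewrite -rmorphM -expr2 sqr_sqrtr//.
  exact: le_trans (sqr_ge0 _) (rnorm2_envelope_ge u s).
- move=> u u0; apply: wk_fieldP => s; apply: rnorm0_eq0.
  have := rnorm2_envelope_ge u s.
  have -> : rnorm2_envelope u s = 0.
    by apply: (@complexI R); rewrite -wk_innerE u0.
  by move=> h; apply/eqP; rewrite -sqrf_eq0 eq_le h sqr_ge0.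
- exact: module_complete.
Qed.

End hilbert_module.

(** * Suprema of projections and gluing *)

Section kaplansky.
Context {R : realType} {D : stoneanType} {X : hilbertBundle R D}.
Local Notation C := (Cplx R).
Local Notation CT := (cfun R D).
Local Notation mnorm := (module_norm (@cfun_norm R D) (@wk_inner R D X)).
Local Notation proj := (projection (@cfun_star R D)).
Local Notation psup := (projection_sup (@cfun_star R D)).

Lemma wk_scaleE (f : CT) (v : wk_field X) s : (f *: v) s = cfun_eval f s *: v s.
Proof. by []. Qed.

(** Test against an element of Omega passing through v s. *)
Lemma weakly_continuous_eq0_closure (v : forall s, X s) (U : set D) :
  weakly_continuous v -> (forall s, U s -> v s = 0) ->
  forall s, closure U s -> v s = 0.
Proof.
move=> /weakly_continuousP vc v0 s sU.
have [w Ow ws] := Omega_through s (v s).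
have h : rinner (v s) (w s) = 0.
  apply: (eq_on_closure (fun t => rinner (v t) (w t)) 0 U _ (vc w Ow) _ s sU).
    exact: Rhausdorff.
  by move=> t Ut; rewrite v0// /rinner linear0l.
by apply: rnorm0_eq0; apply/eqP; rewrite -sqrf_eq0 rnorm_sqr -{2}ws h.
Qed.

Lemma wk_sup (I : Type) (e : I -> CT) (p : CT) (v : wk_field X) :
  (forall i, proj (e i)) -> psup e p ->
  (forall i, e i *: v = 0) -> p *: v = 0.
Proof.
move=> pe psup ev; apply: wk_fieldP => s; rewrite wk_scaleE.
have [->|ps] := eqVneq (cfun_eval p s) 0; first by rewrite scale0r.
rewrite (weakly_continuous_eq0_closure _ [set t | exists i, e i t != 0]
  (@wk_continuous _ _ _ v)) ?scaler0//.
  move=> t [i eit]; have : (e i *: v) t = 0 by rewrite ev.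
  by rewrite wk_scaleE => /eqP; rewrite scaler_eq0 (negbTE eit) => /eqP.
apply: (projection_sup_closure _ _ _ _ _ (support_union_open I e) pe psup) => //.
by move=> i t eit; exists i.
Qed.

Section extension.
Variables (U : set D) (oU : open U) (dU : closure U = setT).
Variables (v0 : forall s, X s) (M : R).
Hypothesis v0M : forall s, U s -> rnorm (v0 s) <= M.
Hypothesis v0c : forall w, Omega w -> forall s, U s ->
  {for s, continuous (fun t => rinner (v0 t) (w t))}.

Let dense_eq (f g : D -> R) : continuous f -> continuous g ->
  (forall s, U s -> f s = g s) -> f =1 g.
Proof.
move=> fc gc fg s; apply/eqP; rewrite -subr_eq0; apply/eqP.
apply: (eq_on_closure (fun t => f t - g t) 0 U); first exact: Rhausdorff.
- by move=> t; apply: cvgB; [exact: fc|exact: gc].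
- by move=> t Ut; rewrite fg// subrr.
- by rewrite dU.
Qed.

Let dense_le (f g : D -> R) : continuous f -> continuous g ->
  (forall s, U s -> f s <= g s) -> forall s, f s <= g s.
Proof.
move=> fc gc fg s; suff -> : f s = Num.min (f s) (g s) by rewrite ge_min lexx orbT.
apply: (dense_eq f (fun t => Num.min (f t) (g t))) => // [t|t Ut].
  exact: (continuous_min (fc t) (gc t)).
by rewrite min_l// fg.
Qed.

(** The hypothesis on w sits inside the existential so that the axiom of choice
    yields a total family indexed by all vector fields. *)
Lemma dense_extension_rinner (w : forall s, X s) : exists g : D -> R, Omega w ->
  continuous g /\ forall s, U s -> g s = rinner (v0 s) (w s).
Proof.
have [Ow|] := pselect (Omega w); last by exists (cst 0).
have [W wW] := cfun_bounded (mk_cfun (@Omega_norm _ _ _ _ Ow)).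
have {}wW s : rnorm (w s) <= complex.Re W.
  by have := wW s; rewrite normr_id normC_rnorm lecE /= => /andP[].
have [|g gc gU] := dense_extension U (fun s => rinner (v0 s) (w s)) (M * complex.Re W)
    (@stonean_extremally_disconnected D) oU _ (v0c w Ow).
  move=> s Us; apply: le_trans (rinner_le _ _) _.
  by apply: ler_pM; rewrite ?rnorm_ge0 ?v0M.
by exists g.
Qed.

(** The pairings of v0 with Omega extend as scalar functions, and at each s the
    extended values form a bounded functional on the fibre, which [riesz] turns
    into a vector. *)
Lemma weakly_continuous_extension : exists v : wk_field X,
  forall s, U s -> v s = v0 s.
Proof.
have /choice[G hG] := dense_extension_rinner.
have Gc w Ow := (hG w Ow).1.
have GU w Ow := (hG w Ow).2.
have GD w1 w2 : Omega w1 -> Omega w2 ->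
    G (fun s => w1 s + w2 s) =1 (fun s => G w1 s + G w2 s).
  move=> O1 O2; have O12 := Omega_add O1 O2; apply: dense_eq; first exact: Gc.
    by move=> s; apply: cvgD; exact: Gc.
  by move=> s Us; rewrite !GU// rinnerDr.
have OZ (a : R) (w : forall s, X s) : Omega w -> Omega (fun s => a%:C%C *: w s).
  by move=> Ow; exact: (@Omega_scale _ _ X (cfun_cst D a%:C%C) w Ow).
have GZ (a : R) w : Omega w -> G (fun s => a%:C%C *: w s) =1 (fun s => a * G w s).
  move=> Ow; apply: dense_eq; first exact/Gc/OZ.
    by move=> s; apply: cvgM; [exact: cvg_cst|exact: Gc].
  by move=> s Us; rewrite !GU ?rinnerZr//; exact: OZ.
have GM w s : Omega w -> `|G w s| <= M * rnorm (w s).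
  move=> Ow; apply: (dense_le (fun t => `|G w t|) (fun t => M * rnorm (w t))).
  - by move=> t; apply: cvg_norm; exact: Gc.
  - by move=> t; apply: cvgM; [exact: cvg_cst|exact: Omega_rnorm].
  - move=> t Ut; rewrite GU//; apply: le_trans (rinner_le _ _) _.
    by rewrite ler_wpM2r ?rnorm_ge0 ?v0M.
(* G w s depends on w only through its value at s: apply the bound GM to the
   difference w1 - w2, which vanishes at s. *)
have G_local w1 w2 s : Omega w1 -> Omega w2 -> w1 s = w2 s -> G w1 s = G w2 s.
  move=> O1 O2 w12; have Ob := Omega_add O1 (OZ (-1) _ O2).
  have := GM _ s Ob; rewrite GD ?GZ//; last exact: OZ.
  rewrite w12 mulN1r rmorphN1 scaleN1r subrr rnorm0 mulr0 normr_le0 subr_eq0.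
  by move/eqP.
pose W s (x : X s) := sval (cid2 (Omega_through s x)).
have WO s x : Omega (W s x) by rewrite /W; case: cid2.
have Ws s x : W s x s = x by rewrite /W; case: cid2.
have hv s : exists2 y : X s, forall x, rinner y x = G (W s x) s & rnorm y <= `|M|.
  apply: riesz => [x y|a x|x].
  - rewrite -GD//; apply: G_local => //; first exact: Omega_add.
    by rewrite !Ws.
  - rewrite -GZ//; apply: G_local => //; first exact: OZ.
    by rewrite !Ws.
  - by have := GM _ s (WO s x); rewrite Ws.
pose v s := sval (cid2 (hv s)).
have vG w s : Omega w -> rinner (v s) (w s) = G w s.
  by move=> Ow; rewrite /v; case: cid2 => y /= -> _; apply: G_local.
have vM s : rnorm (v s) <= `|M| by rewrite /v; case: cid2.
have vc : weakly_continuous v.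
  apply/weakly_continuousP => w Ow.
  by rewrite (_ : (fun s => _) = G w); [exact: Gc|apply/funext => s; exact: vG].
have vb : exists K : C, forall s, `|v s| <= K.
  by exists (`|M|%:C%C) => s; rewrite normC_rnorm lecR.
exists (WkField vc vb) => s Us /=.
have [w Ow ws] := Omega_through s (v s - v0 s).
apply/eqP; rewrite -subr_eq0; apply/eqP/rnorm0_eq0/eqP.
rewrite -sqrf_eq0 rnorm_sqr -{2}ws rinnerDl rinnerNl vG// GU// subrr//.
Qed.

End extension.

(** The supports of the e i are disjoint, so the fields v_ i fit together on their
    union, which is dense because the supremum of the e i is 1. *)
Lemma wk_glue (I : Type) (e : I -> CT) (v_ : I -> wk_field X) :
  orthogonal_projections (@cfun_star R D) e -> psup e 1 ->
  (exists M : R, forall i, mnorm (v_ i) <= M) ->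
  exists v : wk_field X, forall i, e i *: v = e i *: v_ i.
Proof.
move=> [pe oe] e1 [M vM].
pose U := [set s | exists i, e i s != 0].
have oU : open U := support_union_open I e.
have dU : closure U = setT.
  apply/seteqP; split=> // s _.
  apply: (projection_sup_closure _ _ _ _ _ oU pe e1).
    by move=> i t eit; exists i.
  by rewrite mk_cfunE oner_eq0.
have e_inj i j s : e i s != 0 -> e j s != 0 -> i = j.
  move=> ei ej; apply: contrapT => /oe eij.
  have : cfun_eval (e i * e j) s = 0 by rewrite eij.
  by rewrite cfunME => /eqP; rewrite mulf_eq0 (negbTE ei) (negbTE ej).
pose v0 s : X s :=
  if pselect (exists i, e i s != 0) is left h then v_ (sval (cid h)) s else 0.
have v0E i s : e i s != 0 -> v0 s = v_ i s.
  move=> ei; rewrite /v0; case: pselect => [h|[]]; last by exists i.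
  by case: cid => j /= ej; rewrite (e_inj _ _ _ ej ei).
have [||v vv0] := weakly_continuous_extension U oU dU v0 M.
- move=> s [i ei]; rewrite (v0E i)//; exact: le_trans (rnorm_le_module_norm _ _) (vM i).
- move=> w Ow s [i ei].
  have vic := proj1 (weakly_continuousP _) (@wk_continuous _ _ _ (v_ i)) w Ow s.
  rewrite /prop_for /continuous_at (v0E i)//; apply: cvg_trans vic.
  apply: near_eq_cvg; have : nbhs s [set t | e i t != 0].
    by apply: open_nbhs_nbhs; split => //; exact: cfun_support_open.
  by apply: filterS => t eit; rewrite (v0E i).
exists v => i; apply: wk_fieldP => s; rewrite !wk_scaleE.
have [->|ei] := eqVneq (cfun_eval (e i) s) 0; first by rewrite !scale0r.
by rewrite vv0 ?(v0E i)//; exists i.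
Qed.

End kaplansky.

Theorem theorem2p6 (R : realType) (Delta : stoneanType)
    (X : hilbertBundle R Delta) :
  (forall nu1 nu2 : wk_field X,
     exists! h : cfun R Delta, agrees_off_meagre nu1 nu2 h) /\
  is_kaplansky_hilbert_module (@cfun_scale R Delta) (@cfun_star R Delta)
    (@cfun_norm R Delta) (@wk_inner R Delta X).
Proof.
split=> [u v|].
  have [h hP] := agrees_off_meagre_exists u v.
  by exists h; split=> // k; exact: agrees_off_meagre_unique.
split.
- exact: wk_inner_hilbert_module.
- exact: mulrC.
- exact: cfun_awstar.
- by move=> I e p v [pe _]; exact: wk_sup.
- exact: wk_glue.
- by move=> v /(_ 1); rewrite scale1r.
Qed.
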